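(* Let $q$ be a complex number with $0<|q|<1$, let $n\ge1$ and $k\ge1$ be integers, and let $z,t$ be complex numbers with $z\ne0$, $zq^{m}\ne1$ for all integers $-k\le m\le n-1$, and $tq^{m}\ne1$ for all integers $0\le m\le n-1$. Then $$\sum_{i_1=1}^{n}\frac{q^{i_1}}{(1-q^{i_1})(1-zq^{i_1-1})}\sum_{i_2=1}^{i_1}\frac{q^{i_2}}{(1-q^{i_2})(1-zq^{i_2-2})}\cdots\sum_{i_k=1}^{i_{k-1}}\frac{q^{i_k}}{(1-q^{i_k})(1-zq^{i_k-k})}\sum_{r=1}^{i_k}\left(\frac{1}{1-zq^{r-k-1}}-\frac{1}{1-tq^{r-1}}\right)$$ $$=\sum_{r\ge1}\begin{bmatrix}n\\ r\end{bmatrix}\frac{(q;q)_{r-1}(tz^{-1}q^k;q)_r(z;q)_{n-r}}{(zq^{-k};q)_{n+k}(t;q)_r(1-q^r)^k}z^r.$$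
   Context: Notation: $(x;q)_0=1$ and $(x;q)_n=\prod_{i=1}^{n}(1-xq^{i-1})$. The Gaussian binomial coefficient is $\begin{bmatrix}n\\ r\end{bmatrix}=\frac{[n][n-1]\cdots[n-r+1]}{[r][r-1]\cdots[1]}$ with $[n]=\frac{1-q^n}{1-q}$; it is $0$ for $r>n$, so the sum over $r\ge1$ is the finite sum over $1\le r\le n$. *)

(* Defs.v *)
From mathcomp Require Export all_boot all_order all_algebra.
From mathcomp Require Export reals complex.

Set Implicit Arguments.
Unset Strict Implicit.
Unset Printing Implicit Defensive.

Import GRing.Theory.
Local Open Scope ring_scope.

(* (x; q)_n *)
Definition qpoch (K : fieldType) (x q : K) (n : nat) : K :=
  \prod_(1 <= i < n.+1) (1 - x * q ^+ i.-1).

(* [n] *)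
Definition qnum (K : fieldType) (q : K) (n : nat) : K :=
  (1 - q ^+ n) / (1 - q).

(* The truncated subtraction [n - i] is harmless: for r > n the numerator
   contains the factor [0] = 0, so the coefficient vanishes. *)
Definition qbin (K : fieldType) (q : K) (n r : nat) : K :=
  (\prod_(0 <= i < r) qnum q (n - i)) / (\prod_(0 <= i < r) qnum q (r - i)).

(* [nested_sum q z t d j m] consists of the sums at levels j, ..., j + d - 1
   (the outermost one being over 1 <= i_j <= m) followed by the innermost sum
   over r, which sits at level j + d. With j = 1 and d = k the innermost level
   is k + 1, whence the exponent r - k - 1 there. The exponents of q in the
   factors involving z may be negative, hence are integers. *)
Fixpoint nested_sum (K : fieldType) (q z t : K) (d j m : nat) {struct d} : K :=
  if d is d'.+1 then
    \sum_(1 <= i < m.+1)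
      q ^+ i / ((1 - q ^+ i) * (1 - z * q ^ (i%:Z - j%:Z)))
        * nested_sum q z t d' j.+1 i
  else
    \sum_(1 <= r < m.+1)
      ((1 - z * q ^ (r%:Z - j%:Z))^-1 - (1 - t * q ^+ r.-1)^-1).

(* Main.v *)
Require Import Defs.
From mathcomp Require Import ring zify.

(** Write S_d(z, n) for the right-hand side with the parameter d in place of k
    ([qseries] below); it makes sense for d = 0 as well, when the nested sum
    has only its innermost level. The proof is a double induction, on d and on
    the upper bound n, resting on the difference S_d(z, n+1) - S_d(z, n).

    The single identity behind it is the following variant of the q-Pascal rule
    ([qbin_pascal]), where [n, r] is the Gaussian binomial coefficient and
    1 <= r <= n+1:
      [n+1, r] (z)_{n+1-r} - (1 - z q^n) [n, r] (z)_{n-r}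
        = [n+1, r] q^{n+1-r} (1 - q^r) / (1 - q^{n+1}) (z/q)_{n+1-r}.
    It turns the difference of the r-th terms of S_d(z, n+1) and S_d(z, n) into
    one product ([qseries_diff]).

    For d > 0 the factor 1 - q^r lowers the power of 1 - q^r by one, the
    factor q^{-r} is absorbed by replacing z with z/q, and (t z^{-1} q^d)_r is
    the same for the pairs (d, z) and (d - 1, z/q). Hence, term by term,
      S_d(z, n+1) - S_d(z, n)
        = q^{n+1} / ((1 - q^{n+1}) (1 - z q^n)) S_{d-1}(z/q, n+1),
    which is the recursion of the nested sums ([qseriesS_diff]), as lowering
    the level of a nested sum amounts to replacing z with z/q
    ([nested_sum_shift]).

    For d = 0 the difference is a terminating series that has to be summed to
    1 / (1 - z q^n) - 1 / (1 - t q^n). It is, read backwards in r, a truncation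
    of a 2phi1(a, b; abq; q, q) series with a = z/q and b = q^{-n}/t (for
    nonzero t), and such a series telescopes:
      sum_{s <= m} (a)_s (b)_s q^s / ((q)_s (abq)_s)
        = (aq)_m (bq)_m / ((q)_m (abq)_m).
    The partial sums are, normalised so that t = 0 is allowed, the [qtail]; the
    summation is [qseries0_diff].

    Everything but the final step takes place over an arbitrary field in which
    q is neither zero nor a root of unity. *)

Import Order.TTheory GRing.Theory Num.Theory.

Set Implicit Arguments.
Unset Strict Implicit.
Unset Printing Implicit Defensive.

Local Open Scope ring_scope.

(** * q-Pochhammer symbols *)

Lemma qpochS (K : fieldType) (x q : K) n :
  qpoch x q n.+1 = qpoch x q n * (1 - x * q ^+ n).
Proof. by rewrite /qpoch big_nat_recr. Qed.

Lemma qpoch0 (K : fieldType) (x q : K) : qpoch x q 0 = 1.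
Proof. by rewrite /qpoch big_geq. Qed.

Lemma qpochSl (K : fieldType) (x q : K) n :
  qpoch x q n.+1 = (1 - x) * qpoch (x * q) q n.
Proof.
elim: n => [|n IHn]; first by rewrite qpochS !qpoch0 expr0; ring.
rewrite qpochS IHn qpochS exprS; ring.
Qed.

Lemma qpoch_neq0_le (K : fieldType) (x q : K) m n :
  (m <= n)%N -> qpoch x q n != 0 -> qpoch x q m != 0.
Proof.
move=> /subnKC <-; elim: (n - m)%N => [|d IHd]; first by rewrite addn0.
by rewrite addnS qpochS mulf_eq0 negb_or => /andP[/IHd].
Qed.

Lemma qpoch_neq0P (K : fieldType) (x q : K) n :
  reflect (forall i, (i < n)%N -> x * q ^+ i != 1) (qpoch x q n != 0).
Proof.
apply: (iffP idP) => [nz i lt_in | ].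
  have := qpoch_neq0_le lt_in nz; rewrite qpochS mulf_eq0 negb_or.
  by rewrite subr_eq0 [1 == _]eq_sym => /andP[].
elim: n => [|n IHn] nz1; first by rewrite qpoch0 oner_neq0.
rewrite qpochS mulf_neq0 //; last by rewrite subr_eq0 eq_sym nz1.
by apply: IHn => i lt_in; rewrite nz1 // ltnW.
Qed.

(** * Gaussian binomial coefficients *)

Section NotRootOfUnity.

Variables (K : fieldType) (q : K).
Hypothesis q_neq0 : q != 0.
Hypothesis qX_neq1 : forall i, 1 - q ^+ i.+1 != 0.

Lemma qpoch_qq_neq0 n : qpoch q q n != 0.
Proof.
elim: n => [|n IHn]; first by rewrite qpoch0 oner_neq0.
by rewrite qpochS -exprS mulf_neq0.
Qed.

(** The numerator of the Gaussian binomial coefficient in terms of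
    q-factorials; the case r = n gives its denominator. *)
Lemma qfalling_qpoch n r : (r <= n)%N ->
  \prod_(0 <= i < r) qnum q (n - i) * (1 - q) ^+ r * qpoch q q (n - r)
  = qpoch q q n.
Proof.
have q1 : 1 - q != 0 by have := qX_neq1 0%N; rewrite expr1.
elim: r => [|r IHr] lt_rn; first by rewrite big_geq // !mul1r subn0.
rewrite -(IHr (ltnW lt_rn)) big_nat_recr //=.
rewrite -[in RHS](subnSK lt_rn) qpochS -exprS subnSK // /qnum exprS.
by field.
Qed.

Lemma qbin_qpoch n r : (r <= n)%N ->
  qbin q n r = qpoch q q n / (qpoch q q r * qpoch q q (n - r)).
Proof.
move=> le_rn.
have q1 : 1 - q != 0 by have := qX_neq1 0%N; rewrite expr1.
have := qpoch_qq_neq0 (n - r); have := qpoch_qq_neq0 r.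
have := qfalling_qpoch le_rn; have := qfalling_qpoch (leqnn r).
rewrite subnn qpoch0 mulr1 /qbin => <- <-.
rewrite mulf_eq0 negb_or => /andP[dr0 _] nr0.
by field; rewrite nr0 dr0 expf_neq0.
Qed.

Lemma qbin_small n r : (n < r)%N -> qbin q n r = 0.
Proof.
move=> lt_nr; rewrite /qbin (big_cat_nat (n := n)) ?(ltnW lt_nr) //=.
by rewrite (big_ltn lt_nr) subnn /qnum expr0 subrr !(mul0r, mulr0).
Qed.

(** The upper bound n + 1 is included, where [n, r] vanishes: this is what makes
    the sums for n and n + 1 comparable term by term. For r <= n, dividing by
    [n+1, r] (w)_{n-r} / (1 - q^{n+1}) reduces the identity to
    (1 - q^{n+1}) (1 - w q^{n-r}) - (1 - q^{n+1-r}) (1 - w q^n)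
      = q^{n+1-r} (1 - q^r) (1 - w/q). *)
Lemma qbin_pascal w n r : (0 < r <= n.+1)%N ->
  qbin q n.+1 r * qpoch w q (n.+1 - r)
    - (1 - w * q ^+ n) * (qbin q n r * qpoch w q (n - r))
  = qbin q n.+1 r * (q ^+ (n.+1 - r) * (1 - q ^+ r) / (1 - q ^+ n.+1))
    * qpoch (w / q) q (n.+1 - r).
Proof.
case/andP=> r_gt0; rewrite leq_eqVlt => /predU1P[-> | ].
  rewrite subnn !qpoch0 (qbin_small (ltnSn n)) expr0 mul0r mulr0 subr0 mul1r.
  by rewrite divff // !mulr1.
rewrite ltnS => le_rn; rewrite !qbin_qpoch ?(leqW le_rn) // subSn //.
rewrite (qpochSl (w / q)) divfK // !qpochS -!exprS.
have := qpoch_qq_neq0 (n - r); have := qpoch_qq_neq0 r.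
have := qX_neq1 (n - r); have := qX_neq1 n.
have -> : q ^+ n.+1 = q ^+ (n - r).+1 * q ^+ r by rewrite -exprD addSn subnK.
have -> : q ^+ n = q ^+ (n - r) * q ^+ r by rewrite -exprD subnK.
rewrite !exprS.
move: (qpoch q q _) (qpoch q q _) (qpoch q q _) (qpoch w q _) => a b c e.
move: (q ^+ _) (q ^+ _) => x y h1 h2 h3 h4.
by field; rewrite h1 h2 h3 h4 q_neq0.
Qed.

(** * The right-hand side and its differences in n *)

Lemma qpoch_shift d w n :
  qpoch (w * q ^- d) q (n.+1 + d) =
  qpoch (w * q ^- d) q (n + d) * (1 - w * q ^+ n).
Proof.
by rewrite addSn qpochS [(n + d)%N]addnC exprD mulrA mulfVK ?expf_neq0.
Qed.

Definition qseries (d : nat) (w t : K) n :=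
  \sum_(1 <= r < n.+1)
    qbin q n r
      * (qpoch q q r.-1 * qpoch (t * w^-1 * q ^+ d) q r * qpoch w q (n - r))
      / (qpoch (w * q ^- d) q (n + d) * qpoch t q r * (1 - q ^+ r) ^+ d)
      * w ^+ r.

Lemma qseries0 d w t : qseries d w t 0 = 0.
Proof. by rewrite /qseries big_geq. Qed.

(** Both sums, taken over 1 <= r <= n + 1, are proportional term by term to the
    two sides of [qbin_pascal], once brought over the denominator of the one
    for n + 1. *)
Lemma qseries_diff d w t n :
    qpoch (w * q ^- d) q (n.+1 + d) != 0 -> qpoch t q n.+1 != 0 ->
  qseries d w t n.+1 - qseries d w t n =
  \sum_(1 <= r < n.+2)
    qbin q n.+1 r * (q ^+ (n.+1 - r) * (1 - q ^+ r) / (1 - q ^+ n.+1))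
      * (qpoch q q r.-1 * qpoch (t * w^-1 * q ^+ d) q r
         * qpoch (w / q) q (n.+1 - r))
      / (qpoch (w * q ^- d) q (n.+1 + d) * qpoch t q r * (1 - q ^+ r) ^+ d)
      * w ^+ r.
Proof.
move=> nzw nzt; rewrite /qseries.
(* The term r = n + 1 of the second sum vanishes with [n, n + 1]. *)
rewrite [X in _ - X](_ : _ = \sum_(1 <= r < n.+2)
    qbin q n r
      * (qpoch q q r.-1 * qpoch (t * w^-1 * q ^+ d) q r * qpoch w q (n - r))
      / (qpoch (w * q ^- d) q (n + d) * qpoch t q r * (1 - q ^+ r) ^+ d)
      * w ^+ r); last first.
  by rewrite [RHS]big_nat_recr //= qbin_small // !mul0r addr0.
rewrite -sumrB; apply: eq_big_nat => r /andP[r_gt0 lt_rn].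
have nzr : (1 - q ^+ r) ^+ d != 0 by rewrite expf_neq0 // -(prednK r_gt0).
have nztr := @qpoch_neq0_le _ _ _ r n.+1 lt_rn nzt.
move: nzw; rewrite qpoch_shift mulf_eq0 negb_or => /andP[nzQ nzf].
have pascal := qbin_pascal w (introT andP (conj r_gt0 lt_rn)).
transitivity (
  (qbin q n.+1 r * qpoch w q (n.+1 - r)
    - (1 - w * q ^+ n) * (qbin q n r * qpoch w q (n - r)))
  * (qpoch q q r.-1 * qpoch (t * w^-1 * q ^+ d) q r * w ^+ r)
  / (qpoch (w * q ^- d) q (n + d) * (1 - w * q ^+ n) * qpoch t q r
     * (1 - q ^+ r) ^+ d)).
  by field; rewrite nzQ nzf nzr nztr.
rewrite pascal; ring.
Qed.

(** The relation holds term by term: t w^{-1} q^d and w q^{-d} do not change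
    when (d + 1, w) is replaced with (d, w/q), and the remaining powers agree as
    q^{n+1-r} w^r = q^{n+1} (w/q)^r. *)
Lemma qseriesS_diff d w t n : w != 0 ->
    qpoch (w * q ^- d.+1) q (n.+1 + d.+1) != 0 -> qpoch t q n.+1 != 0 ->
  qseries d.+1 w t n.+1 - qseries d.+1 w t n =
  q ^+ n.+1 / ((1 - q ^+ n.+1) * (1 - w * q ^+ n)) * qseries d (w / q) t n.+1.
Proof.
move=> nzw nzQ nzt; rewrite qseries_diff // /qseries mulr_sumr.
apply: eq_big_nat => r /andP[r_gt0 lt_rn].
have nzr : 1 - q ^+ r != 0 by rewrite -(prednK r_gt0).
have nzrd : (1 - q ^+ r) ^+ d != 0 by rewrite expf_neq0.
have nztr : qpoch t q r != 0 by apply: qpoch_neq0_le nzt.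
have -> : t * (w / q)^-1 * q ^+ d = t * w^-1 * q ^+ d.+1.
  by rewrite exprS; field; rewrite nzw q_neq0.
have -> : w / q * q ^- d = w * q ^- d.+1.
  by rewrite exprS invfM mulrA.
move: nzQ; rewrite qpoch_shift mulf_eq0 negb_or addSnnS => /andP[nzQ nzf].
have -> : q ^+ n.+1 = q ^+ (n.+1 - r) * q ^+ r by rewrite -exprD subnK.
have := qX_neq1 n.
have -> : q ^+ n.+1 = q ^+ (n.+1 - r) * q ^+ r by rewrite -exprD subnK.
have qr0 : q ^+ r != 0 by rewrite expf_neq0.
rewrite exprMn exprVn [(1 - q ^+ r) ^+ d.+1]exprS => nzn.
by field; rewrite ?nzn ?nzQ ?nzf ?nztr ?nzrd ?nzr ?qr0.
Qed.

(** The sum of the terms with r > p (for p <= n) in the difference of [qseries 0 w t] between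
    n and n + 1, in closed form. *)
Definition qtail w t n p :=
  q ^+ (n - p) * qpoch w q (n - p) * (qpoch (t / w) q p.+1 * w ^+ p.+1)
    * qpoch q q n
  / (qpoch q q (n - p) * (1 - t * q ^+ n) * qpoch t q p * qpoch w q n.+1).

(** The terms r <= n of the difference given by [qseries_diff] are
    qtail (r - 1) - qtail r and the term r = n + 1 is qtail n, so the sum is
    qtail 0 = q^n (w - t) / ((1 - t q^n) (1 - w q^n)). *)
Lemma qseries0_diff (w t : K) n : w != 0 ->
    qpoch w q n.+1 != 0 -> qpoch t q n.+1 != 0 ->
  qseries 0 w t n.+1 - qseries 0 w t n =
  (1 - w * q ^+ n)^-1 - (1 - t * q ^+ n)^-1.
Proof.
move=> w0 nzw nzt; rewrite qseries_diff ?invr1 ?mulr1 ?addn0 //.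
move: (nzw) (nzt); rewrite !qpochS !mulf_eq0 !negb_or.
move=> /andP[nzwn nzwf] /andP[nztn nztf].
rewrite big_nat_recr //=.
rewrite (eq_big_nat _ _ (F2 := fun r => - qtail w t n r - - qtail w t n r.-1));
  last first.
  case=> // p /andP[_ lt_pn].
  have nztp : qpoch t q p.+1 != 0 by apply: qpoch_neq0_le nzt; apply: ltnW.
  rewrite qbin_qpoch 1?ltnW // /qtail /= subSS -(subnSK (lt_pn : (p < n)%N)).
  have := qX_neq1 p; have := qX_neq1 n; have := qX_neq1 (n - p.+1).
  have := qpoch_qq_neq0 p; have := qpoch_qq_neq0 (n - p.+1).
  move: nztp nzwf nztf; rewrite qpochS mulf_eq0 negb_or => /andP[nztp nztpf].
  rewrite (qpochSl (w / q)) divfK // !qpochS -!exprS !expr0.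
  have -> : q ^+ n = q ^+ (n - p.+1) * (q * q ^+ p).
    by rewrite -exprS -exprD subnK.
  rewrite !exprS => nzwf nztf h1 h2 h3 h4 h5.
  by field; rewrite q_neq0 w0 nztp nztpf nzwn nzwf nztf h1 h2 h3 h4 h5.
rewrite big_add1 telescope_sumr //= /qtail !subnn subn0.
rewrite qbin_qpoch // subnn !qpochS !qpoch0 !expr0.
have := qX_neq1 n; have := qpoch_qq_neq0 n; rewrite exprS => h1 h2.
by field; rewrite w0 nzwn nzwf nztn nztf h1 h2.
Qed.

(** * The nested sum *)

(** The level occurs only through the products z q^{-j}. *)
Lemma nested_sum_shift z t d j m :
  nested_sum q z t d j.+1 m = nested_sum q (z / q) t d j m.
Proof.
have shift (i : nat) l : z * q ^ (i%:Z - l.+1%:Z) = z / q * q ^ (i%:Z - l%:Z).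
  have -> : i%:Z - l.+1%:Z = -1 + (i%:Z - l%:Z) by lia.
  by rewrite (expfzDr (-1)) // exprN1 mulrA.
elim: d j m => [|d IHd] j m /=; apply: eq_bigr => i _; first by rewrite shift.
by rewrite shift IHd.
Qed.

(** Both sides vanish for n = 0 and have the same differences in n, by induction
    on d for the inner nested sum, which has w / q in place of w. *)
Lemma nested_sum_qseries d w t n : w != 0 ->
    qpoch (w * q ^- d) q (n + d) != 0 -> qpoch t q n != 0 ->
  nested_sum q w t d 1 n = qseries d w t n.
Proof.
elim: d w n => [|d IHd] w n nzw; elim: n => [|n IHn] nzQ nzt.
- by rewrite qseries0 /= big_geq.
- have nzt' : qpoch t q n != 0 by apply: qpoch_neq0_le nzt.
  have nzQ' : qpoch (w * q ^- 0) q (n + 0) != 0 by apply: qpoch_neq0_le nzQ; lia.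
  move: (IHn nzQ' nzt') => /= IH; rewrite big_nat_recr //= IH.
  move: nzQ; rewrite addn0 expr0 invr1 mulr1 => nzQ.
  have -> : n.+1%:Z - 1 = n by lia.
  by rewrite -exprnP -qseries0_diff // addrC subrK.
- by rewrite qseries0 /= big_geq.
have nzt' : qpoch t q n != 0 by apply: qpoch_neq0_le nzt.
have nzQ' : qpoch (w * q ^- d.+1) q (n + d.+1) != 0.
  by apply: qpoch_neq0_le nzQ; lia.
move: (IHn nzQ' nzt') => /= IH; rewrite big_nat_recr //= IH.
rewrite nested_sum_shift IHd ?mulf_neq0 ?invr_eq0 //; last first.
  have -> : w / q * q ^- d = w * q ^- d.+1 by rewrite exprS invfM mulrA.
  by apply: qpoch_neq0_le nzQ; lia.
have -> : n.+1%:Z - 1 = n by lia.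
by rewrite -exprnP -qseriesS_diff // addrC subrK.
Qed.

End NotRootOfUnity.

Theorem propositionC (R : realType) (q : complex R) (n k : nat)
    (z t : complex R)
    (hq : 0 < `|q| < 1) (hn : (1 <= n)%N) (hk : (1 <= k)%N) (hz : z != 0)
    (hzq : forall m : int, - k%:Z <= m <= n%:Z - 1 -> z * q ^ m != 1)
    (htq : forall m : int, 0 <= m <= n%:Z - 1 -> t * q ^ m != 1) :
  nested_sum q z t k 1 n =
  \sum_(1 <= r < n.+1)
    qbin q n r
      * (qpoch q q r.-1 * qpoch (t * z^-1 * q ^+ k) q r * qpoch z q (n - r))
      / (qpoch (z * q ^- k) q (n + k) * qpoch t q r * (1 - q ^+ r) ^+ k)
      * z ^+ r.
Proof.
case/andP: hq; rewrite normr_gt0 => q_neq0 q_lt1.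
have qX_neq1 i : 1 - q ^+ i.+1 != 0.
  rewrite subr_eq0 eq_sym; apply/eqP => /(congr1 Num.norm).
  rewrite normrX normr1 => /eqP; apply/negP; rewrite lt_eqF //.
  by rewrite exprn_ilt1.
rewrite -/(qseries q k z t n); apply: nested_sum_qseries => //.
  apply/qpoch_neq0P => i lt_i; have := hzq (i%:Z - k%:Z).
  rewrite expfzDr // -exprnP exprnN -mulrA [q ^+ i * _]mulrC; apply; lia.
apply/qpoch_neq0P => i lt_i; apply: (htq i%:Z); lia.
Qed.
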